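(* Let $A$ be a finite-dimensional simple Jordan algebra with unit over $\mathbb C$ and let $l\ge1$. Up to equivalence there are only finitely many finite-dimensional irreducible generalized representations of $A$ of order $l$. In particular, $A$ has only finitely many inequivalent irreducible usual representations (order $l=2$) and only finitely many inequivalent irreducible Jacobson representations (order $l=3$).
   Context: Jordan algebra: commutative algebra satisfying $(x^2y)x=x^2(yx)$, product written $x*y$ or $xy$. $L(A)=U_{-1}\oplus U_0\oplus U_1$: $U_{-1}$ = space of $A$, $U_0=\mathrm{span}\{L_a,[L_a,L_b]\}$ with $L_a(x)=a*x$, $U_1=\mathrm{span}\{\bar A,A_a\}$ with $\bar A(x,y)=x*y$, $A_a(x,y)=(x*a)*y+(y*a)*x-a*(x*y)$; skew bracket $[U_{-1},U_{-1}]=0=[U_1,U_1]$, $[S,a]=S(a)$, $[S_1,S_2]=S_1S_2-S_2S_1$, $[B,a]=(y\mapsto B(a,y))$, $[S,B]=((x,y)\mapsto S(B(x,y))-B(Sx,y)-B(x,Sy))$. Generalized representation of $A$ (unit $e$) on $V$: pair $(\pi,a)$, $a\in\mathrm{End}\,V$, $\pi:A\to\mathrm{End}\,V$ linear with $\pi(x*y)=[[\pi(x),a],\pi(y)]$ and $[a,[\pi(e),a]]=a$; irreducible if no subspace $0\ne W\ne V$ is invariant under $a$ and $\pi(A)$; $(\pi,a)$ on $V$ and $(\nu,b)$ on $W$ are equivalent if some isomorphism $f:V\to W$ has $f\pi(x)=\nu(x)f$, $fa=bf$. $\Phi(\rho)=(\rho|_{U_{-1}},-\rho(\bar A))$ for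 a representation $\rho$ of $L(A)$; $\rho$ on $V$ is $l$-graded if $V=V_1\oplus\dots\oplus V_l$, all $V_j\ne0$, $\rho(U_i)V_j\subset V_{i+j}$ ($V_m=0$ outside $1..l$); a generalized representation is of order $l$ if it is $\Phi(\rho)$ for some $l$-graded $\rho$. A usual representation is a linear $\phi:A\to\mathrm{End}\,V$ with $\phi(xy)=\phi(x)\phi(y)+\phi(y)\phi(x)$. A Jacobson representation is a linear $\phi:A\to\mathrm{End}\,V$ such that $A\oplus V$ with product $x*y=xy$, $u*v=0$, $x*v=v*x=\phi(x)v$ ($x,y\in A$, $u,v\in V$) is a Jordan algebra; irreducibility and equivalence of these are defined in the usual way (no proper nonzero invariant subspace; intertwining isomorphism). *)

(* Defs.v *)
From HB Require Import structures.
From mathcomp Require Import all_boot all_order all_algebra.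
From mathcomp Require Import complex Rstruct.
Set Implicit Arguments.
Unset Strict Implicit.
Unset Printing Implicit Defensive.
Import GRing.Theory.
Local Open Scope ring_scope.

Definition C : numClosedFieldType := complex Rdefinitions.R.

Definition linear_map (U W : lmodType C) (f : U -> W) : Prop :=
  forall (c : C) (u v : U), f (c *: u + v) = c *: f u + f v.

(* A (not necessarily finite-dimensional) Jordan algebra structure on T:
   bilinear (right-linear + commutative), commutative, Jordan identity
   (x^2 y) x = x^2 (y x). *)
Definition is_jordan (T : lmodType C) (m : T -> T -> T) : Prop :=
  [/\ forall x, linear_map (m x),
      forall x y, m x y = m y x &
      forall x y, m (m (m x x) y) x = m (m x x) (m y x)].

Definition lbr (V : vectType C) (f g : 'End(V)) : 'End(V) :=
  ((f \o g) - (g \o f))%VF.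

Section JordanAlgebra.
Variable A : vectType C.
Variable mul : A -> A -> A.

Definition is_ideal (I : {vspace A}) : Prop :=
  forall x y, y \in I -> mul x y \in I.

Definition simple_jordan : Prop :=
  [/\ is_jordan mul,
      exists x y, mul x y != 0 &
      forall I : {vspace A}, is_ideal I -> I = 0%VS \/ I = fullv].

Definition is_unit (e : A) : Prop := forall x, mul e x = x.

Definition Lmul (a : A) : A -> A := fun x => mul a x.
Definition fcomm (S T : A -> A) : A -> A := fun x => S (T x) - T (S x).
Definition Abar : A -> A -> A := mul.
Definition Aa (a : A) : A -> A -> A :=
  fun x y => mul (mul x a) y + mul (mul y a) x - mul a (mul x y).

Definition U0gen (S : A -> A) : Prop :=
  (exists a, S = Lmul a) \/ (exists a b, S = fcomm (Lmul a) (Lmul b)).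
Definition U1gen (B : A -> A -> A) : Prop :=
  B = Abar \/ exists a, B = Aa a.

Definition inU0 (S : A -> A) : Prop :=
  exists s : seq (C * (A -> A)),
    List.Forall (fun p => U0gen p.2) s /\
    S = (fun x => \sum_(p <- s) p.1 *: p.2 x).
Definition inU1 (B : A -> A -> A) : Prop :=
  exists s : seq (C * (A -> A -> A)),
    List.Forall (fun p => U1gen p.2) s /\
    B = (fun x y => \sum_(p <- s) p.1 *: p.2 x y).

(* an element of L(A): (component in U_{-1}, in U_0, in U_1) *)
Record Lel := mkL { lm : A; l0 : A -> A; l1 : A -> A -> A }.
Definition inL (X : Lel) : Prop := inU0 (l0 X) /\ inU1 (l1 X).

Definition Lcomb (c : C) (X Y : Lel) : Lel :=
  mkL (c *: lm X + lm Y) (fun x => c *: l0 X x + l0 Y x)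
      (fun x y => c *: l1 X x y + l1 Y x y).

Definition SB (S : A -> A) (B : A -> A -> A) : A -> A -> A :=
  fun x y => S (B x y) - B (S x) y - B x (S y).

(* the skew bracket of L(A), extended bilinearly from
   [U_-1,U_-1]=0=[U_1,U_1], [S,a]=S(a), [S1,S2]=S1S2-S2S1,
   [B,a]=(y|->B(a,y)), [S,B]=SB S B *)
Definition Lbr (X Y : Lel) : Lel :=
  mkL (l0 X (lm Y) - l0 Y (lm X))
      (fun x => l0 X (l0 Y x) - l0 Y (l0 X x) + l1 X (lm Y) x - l1 Y (lm X) x)
      (fun x y => SB (l0 X) (l1 Y) x y - SB (l0 Y) (l1 X) x y).

Definition Lm (u : A) : Lel := mkL u (fun _ => 0) (fun _ _ => 0).
Definition L0 (S : A -> A) : Lel := mkL 0 S (fun _ _ => 0).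
Definition L1 (B : A -> A -> A) : Lel := mkL 0 (fun _ => 0) B.

Section Reps.
Variable V : vectType C.

Definition is_repL (rho : Lel -> 'End(V)) : Prop :=
  (forall c X Y, inL X -> inL Y -> rho (Lcomb c X Y) = c *: rho X + rho Y) /\
  (forall X Y, inL X -> inL Y -> rho (Lbr X Y) = lbr (rho X) (rho Y)).

Definition grade_sp (l : nat) (Vs : nat -> {vspace V}) (k : nat) : {vspace V} :=
  if (1 <= k <= l)%N then Vs k else 0%VS.

Definition graded (l : nat) (rho : Lel -> 'End(V)) : Prop :=
  exists Vs : nat -> {vspace V},
  [/\ (\sum_(1 <= j < l.+1) Vs j)%VS = fullv,
      directv (\sum_(1 <= j < l.+1) Vs j),
      forall j, (1 <= j <= l)%N -> Vs j != 0%VS &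
    [/\ forall j u, (1 <= j <= l)%N -> (rho (Lm u) @: Vs j <= grade_sp l Vs j.-1)%VS,
      forall j S, (1 <= j <= l)%N -> inU0 S -> (rho (L0 S) @: Vs j <= Vs j)%VS &
      forall j B, (1 <= j <= l)%N -> inU1 B ->
        (rho (L1 B) @: Vs j <= grade_sp l Vs j.+1)%VS]].

Definition is_genrep (e : A) (pi : A -> 'End(V)) (a : 'End(V)) : Prop :=
  [/\ linear_map pi,
      forall x y, pi (mul x y) = lbr (lbr (pi x) a) (pi y) &
      lbr a (lbr (pi e) a) = a].

Definition genrep_irreducible (pi : A -> 'End(V)) (a : 'End(V)) : Prop :=
  forall W : {vspace V}, (a @: W <= W)%VS -> (forall x, (pi x @: W <= W)%VS) ->
    W = 0%VS \/ W = fullv.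

Definition gen_order (l : nat) (pi : A -> 'End(V)) (a : 'End(V)) : Prop :=
  exists rho : Lel -> 'End(V),
    [/\ is_repL rho, graded l rho, (forall x, pi x = rho (Lm x)) &
        a = - rho (L1 Abar)].

Definition usual_rep (phi : A -> 'End(V)) : Prop :=
  linear_map phi /\
  forall x y, phi (mul x y) = ((phi x \o phi y) + (phi y \o phi x))%VF.

Definition jprod (phi : A -> 'End(V)) (z w : (A * V)%type) : (A * V)%type :=
  (mul z.1 w.1, phi z.1 w.2 + phi w.1 z.2).

Definition jacobson_rep (phi : A -> 'End(V)) : Prop :=
  linear_map phi /\ is_jordan (jprod phi).

Definition rep_irreducible (phi : A -> 'End(V)) : Prop :=
  forall W : {vspace V}, (forall x, (phi x @: W <= W)%VS) -> W = 0%VS \/ W = fullv.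

End Reps.

Definition genrep_equiv (V W : vectType C) (pi : A -> 'End(V)) (a : 'End(V))
  (nu : A -> 'End(W)) (b : 'End(W)) : Prop :=
  exists f : 'Hom(V, W),
    [/\ lker f = 0%VS, limg f = fullv,
        forall x, (f \o pi x = nu x \o f)%VF & (f \o a = b \o f)%VF].

Definition rep_equiv (V W : vectType C) (phi : A -> 'End(V)) (psi : A -> 'End(W)) : Prop :=
  exists f : 'Hom(V, W),
    [/\ lker f = 0%VS, limg f = fullv & forall x, (f \o phi x = psi x \o f)%VF].

Definition fin_many_genreps
  (P : forall V : vectType C, (A -> 'End(V)) -> 'End(V) -> Prop) : Prop :=
  exists s : seq {n : nat & ((A -> 'End('rV[C]_n)) * 'End('rV[C]_n))%type},
    forall (V : vectType C) (pi : A -> 'End(V)) (a : 'End(V)), P V pi a ->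
      exists2 r, List.In r s & genrep_equiv pi a (projT2 r).1 (projT2 r).2.

Definition fin_many_reps
  (P : forall V : vectType C, (A -> 'End(V)) -> Prop) : Prop :=
  exists s : seq {n : nat & (A -> 'End('rV[C]_n))},
    forall (V : vectType C) (phi : A -> 'End(V)), P V phi ->
      exists2 r, List.In r s & rep_equiv phi (projT2 r).

End JordanAlgebra.

(* Main.v *)
(* Irreducibles V_1, ..., V_k that are pairwise inequivalent generate their direct sum
   from a single vector (v_1, ..., v_k) with nonzero entries. Hence a class of
   representations that is closed under direct sums, and in which every cyclic
   subrepresentation has dimension at most D, has at most D nonzero irreducibles.
   To get such a D one filters a cyclic module by the length of words in a finite set of
   generators and shows that long words reduce to shorter ones.
   - Usual and Jacobson representations satisfy x b z + z b x = (shorter words), so letters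
     at distance two anticommute modulo shorter words; a word with more than 2 dim A letters
     repeats a letter at even distance, and x b x is shorter.
   - In order l the elements of U_{-1} and U_1 act nilpotently. For q in U_1 and m in U_{-1},
     exp(ad q) m = m + [q,m] + [q,[q,m]]/2 is conjugate to m, hence also nilpotent, and the
     elements [q,m] span U_0. So L(A) is spanned by finitely many elements acting with l-th
     power 0, and letters commute modulo shorter words (Poincare-Birkhoff-Witt). *)

Require Import Defs.
From HB Require Import structures.
From mathcomp Require Import all_boot all_order all_algebra.
From mathcomp Require Import complex Rstruct.
From mathcomp Require Import ring.
From Stdlib Require Import Classical FunctionalExtensionality.
Set Implicit Arguments.
Unset Strict Implicit.
Unset Printing Implicit Defensive.
Import GRing.Theory VectorInternalTheory.
Local Open Scope ring_scope.

(** * Finiteness from bounded cyclic modules *)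

Definition linear_fun (U W : vectType C) (f : U -> W) (hf : linear_map f) :
  {linear U -> W} :=
  HB.pack f (GRing.isLinear.Build C U W *:%R f hf).

Definition linear_hom (U W : vectType C) (f : U -> W) (hf : linear_map f) : 'Hom(U, W) :=
  linfun (linear_fun hf).

Lemma linear_homE (U W : vectType C) (f : U -> W) (hf : linear_map f) u :
  linear_hom hf u = f u.
Proof. by rewrite lfunE. Qed.

Section Pairs.
Variables U V : vectType C.

Lemma inl_linear : linear_map (fun u : U => (u, 0) : U * V).
Proof. by move=> c u v; rewrite [in RHS]/GRing.add /GRing.scale /= /add_pair /scale_pair /= scaler0 addr0. Qed.
Lemma inr_linear : linear_map (fun v : V => (0, v) : U * V).
Proof. by move=> c u v; rewrite [in RHS]/GRing.add /GRing.scale /= /add_pair /scale_pair /= scaler0 addr0. Qed.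
Lemma fst_linear : linear_map (fun p : U * V => p.1).
Proof. by []. Qed.
Lemma snd_linear : linear_map (fun p : U * V => p.2).
Proof. by []. Qed.
Definition inl_hom := linear_hom inl_linear.
Definition inr_hom := linear_hom inr_linear.
Definition fst_hom := linear_hom fst_linear.
Definition snd_hom := linear_hom snd_linear.

Lemma dsum_linear (f : 'End(U)) (g : 'End(V)) :
  linear_map (fun p : U * V => (f p.1, g p.2)).
Proof. by move=> c u v; congr (_, _); rewrite /= linearP. Qed.
Definition dsum f g : 'End((U * V)%type) := linear_hom (dsum_linear f g).
Lemma dsumE f g p : dsum f g p = (f p.1, g p.2).
Proof. exact: linear_homE. Qed.

End Pairs.

Section FinitelyMany.
Variable I : Type.
Notation rep V := (I -> 'End(V)).

Definition stable_under (V : vectType C) (r : rep V) (W : {vspace V}) :=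
  forall i, (r i @: W <= W)%VS.

Definition irreducible_fam (V : vectType C) (r : rep V) :=
  forall W : {vspace V}, stable_under r W -> W = 0%VS \/ W = fullv.

Definition intertwines (V W : vectType C) (r : rep V) (q : rep W) (f : 'Hom(V, W)) :=
  forall i, (f \o r i = q i \o f)%VF.

Definition equivalent (V W : vectType C) (r : rep V) (q : rep W) :=
  exists f : 'Hom(V, W), [/\ lker f = 0%VS, limg f = fullv & intertwines r q f].

Lemma equivalent_sym (V W : vectType C) (r : rep V) (q : rep W) :
  equivalent r q -> equivalent q r.
Proof.
move=> [f [/eqP kf imf fP]].
have fK := lker0_compVf kf.
have fV : (f \o f^-1 = \1)%VF.
  apply/lfunP => w; rewrite comp_lfunE id_lfunE limg_lfunVK //.
  by rewrite imf memvf.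
exists (f^-1)%VF; split.
- apply/eqP/lker0P => x y xy.
  by rewrite -[x](id_lfunE) -[y](id_lfunE) -fV !comp_lfunE xy.
- apply/vspaceP => v; rewrite memvf; apply/memv_imgP; exists (f v); rewrite ?memvf //.
  by rewrite -comp_lfunE fK id_lfunE.
- move=> i; rewrite -[LHS]comp_lfun1r -fV comp_lfunA -[((_ \o q i) \o f)%VF]comp_lfunA.
  by rewrite -(fP i) comp_lfunA fK comp_lfun1l.
Qed.

Lemma equivalent_trans (U V W : vectType C) (p : rep U) (r : rep V) (q : rep W) :
  equivalent p r -> equivalent r q -> equivalent p q.
Proof.
move=> [f [/eqP kf imf fP]] [g [/eqP kg img gP]]; exists (g \o f)%VF; split.
- apply/eqP/lker0P => x y; rewrite !comp_lfunE => /(lker0P kg).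
  exact: (lker0P kf).
- by rewrite limg_comp imf.
- by move=> i; rewrite -comp_lfunA fP comp_lfunA gP comp_lfunA.
Qed.

Lemma schur (V W : vectType C) (r : rep V) (q : rep W) (f : 'Hom(V, W)) :
  irreducible_fam r -> irreducible_fam q -> intertwines r q f -> f != 0 ->
  equivalent r q.
Proof.
move=> irr irq fP fn0; exists f; split=> //.
- case: (irr (lker f)) => // [i|kf].
    apply/subvP => _ /memv_imgP[v + ->]; rewrite !memv_ker => /eqP fv.
    by rewrite -comp_lfunE fP comp_lfunE fv linear0.
  case/eqP: fn0; apply/lfunP => v; apply/eqP.
  by rewrite zero_lfunE -memv_ker kf memvf.
- case: (irq (limg f)) => // [i|imf].
    apply/subvP => _ /memv_imgP[_ /memv_imgP[v _ ->] ->].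
    by rewrite -comp_lfunE -fP comp_lfunE memv_img ?memvf.
  case/eqP: fn0; apply/lfunP => v; apply/eqP.
  by rewrite zero_lfunE -memv0 -imf memv_img ?memvf.
Qed.

Lemma to_rowP (V : vectType C) (f : 'End(V)) :
  linear_map (fun x : 'rV[C]_(dim V) => v2r (f (r2v x))).
Proof. by move=> c x y; rewrite !linearP. Qed.

(** Coordinates give every representation an equivalent copy in one fixed type, so that copies can
    be collected in a list. *)
Definition to_row (V : vectType C) (r : rep V) : rep 'rV[C]_(dim V) :=
  fun i => linear_hom (to_rowP (r i)).

Lemma v2r_linear (V : vectType C) : linear_map (@v2r C V).
Proof. by move=> c x y; rewrite linearP. Qed.

Lemma equivalent_to_row (V : vectType C) (r : rep V) : equivalent r (to_row r).
Proof.
exists (linear_hom (@v2r_linear V)); split.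
- by apply/eqP/lker0P => x y; rewrite !linear_homE => /v2r_inj.
- apply/vspaceP => x; rewrite memvf; apply/memv_imgP; exists (r2v x).
    exact: memvf.
  by rewrite linear_homE r2vK.
- by move=> i; apply/lfunP => v; rewrite !comp_lfunE !linear_homE v2rK.
Qed.

Variable P : forall V : vectType C, rep V -> Prop.
Variable D : nat.
Hypothesis P_zero : P (fun _ => 0 : 'End('rV[C]_0)).
Hypothesis P_dsum : forall (V W : vectType C) (r : rep V) (q : rep W),
  P r -> P q -> P (fun i => dsum (r i) (q i)).
Hypothesis P_cyclic : forall (V : vectType C) (r : rep V), P r -> forall v,
  exists W : {vspace V}, [/\ stable_under r W, v \in W & (\dim W <= D)%N].

Let packed := {n : nat & rep 'rV[C]_n}.

Definition listed (L : seq packed) (V : vectType C) (r : rep V) :=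
  exists2 q : packed, List.In q L & equivalent r (projT2 q).

(* Stands for a direct sum of k pairwise inequivalent irreducibles, all listed in L;
   u is the sum of nonzero vectors of the summands. *)
Definition cyclic_sum (k : nat) (L : seq packed) :=
  exists (U : vectType C) (p : rep U) (u : U),
  [/\ P p, (k <= dim U)%N,
      forall W : {vspace U}, stable_under p W -> u \in W -> W = fullv &
      forall (V : vectType C) (r : rep V) (f : 'Hom(U, V)),
        irreducible_fam r -> intertwines p r f -> f != 0 -> listed L r].

Lemma cyclic_sum0 : cyclic_sum 0 [::].
Proof.
have rv0 (W : {vspace 'rV[C]_0}) : W = fullv.
  by apply/vspaceP => x; rewrite memvf (thinmx0 x) mem0v.
exists 'rV[C]_0, (fun _ => 0), 0; split=> // V r f _ _ /eqP[]; apply/lfunP => x.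
by rewrite (thinmx0 x) !linear0.
Qed.

(** A stable [W] containing [(v, u)] projects onto [U] because [u] is cyclic, and it meets [V] in 0
    or in all of [V]. In the first case [W] is the graph of an intertwiner [U -> V] sending [u] to
    [v != 0], so [r] would already be listed; in the second case [W] is everything. *)
Lemma cyclic_sumS k L (V : vectType C) (r : rep V) (v : V) :
  cyclic_sum k L -> P r -> irreducible_fam r -> v != 0 -> ~ listed L r ->
  cyclic_sum k.+1 (existT _ (dim V) (to_row r) :: L).
Proof.
move=> [U [p [u [Pp kU cyc homU]]]] Pr irr vn0 nL.
exists (V * U)%type, (fun i => dsum (r i) (p i)), (v, u); split.
- exact: P_dsum.
- suff : (0 < dim V)%N by move=> /(leq_add); apply.
  rewrite -dimvf lt0n dimv_eq0; apply: contraNneq vn0 => V0.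
  by rewrite -memv0 -V0 memvf.
- move=> W invW vuW.
  have invWE i w : w \in W -> (r i w.1, p i w.2) \in W.
    by move=> wW; rewrite -(dsumE (r i)); apply: (subvP (invW i)); apply: memv_img.
  have subW x y z : (x, z) \in W -> (y, z) \in W -> (x - y, 0) \in W.
    move=> xW yW; have := memvB xW yW.
    by rewrite [X in X \in _]/GRing.add /= /add_pair /= subrr.
  have sndW : (snd_hom V U @: W)%VS = fullv.
    apply: cyc => [i|]; last by apply/memv_imgP; exists (v, u); rewrite ?linear_homE.
    apply/subvP => _ /memv_imgP[_ /memv_imgP[w wW ->] ->]; apply/memv_imgP.
    by exists (r i w.1, p i w.2); rewrite ?invWE // !linear_homE.
  case: (irr (inl_hom V U @^-1: W)%VS) => [i|K0|K1].
  + apply/subvP => _ /memv_imgP[x xK ->]; move: xK; rewrite -!memv_preim !linear_homE.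
    by move=> /(invWE i) /=; rewrite linear0.
  + have uniqW x y z : (x, z) \in W -> (y, z) \in W -> x = y.
      move=> xW yW; apply: subr0_eq; apply/eqP.
      by rewrite -memv0 -K0 -memv_preim linear_homE (subW _ _ z).
    (* [S] plays the second projection restricted to [W]; with its pseudo-inverse, [f y] is the
       [V]-component of the point of [W] above [y]. *)
    pose S := (snd_hom V U \o projv W)%VF.
    pose f := (fst_hom V U \o projv W \o S^-1)%VF.
    have fW y : (f y, y) \in W.
      have yS : y \in limg S by rewrite limg_comp limg_proj sndW memvf.
      have := memv_proj W ((S^-1)%VF y); rewrite !comp_lfunE.
      rewrite -{3}(limg_lfunVK yS) comp_lfunE !linear_homE.
      by case: (projv _ _).
    case: nL; apply: (homU V r f irr) => [i|].
      apply/lfunP => y; rewrite (comp_lfunE f) (comp_lfunE (r i)).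
      exact: uniqW (fW _) (invWE i _ (fW y)).
    apply/eqP => f0; case/eqP: vn0; apply: uniqW vuW _.
    by have := fW u; rewrite f0 zero_lfunE.
  + apply/vspaceP => -[x y]; rewrite memvf.
    have /memv_imgP[[w1 w2] wW] : y \in (snd_hom V U @: W)%VS by rewrite sndW memvf.
    rewrite linear_homE /= => ->.
    have xW : (x - w1, 0) \in W.
      by have := memvf (x - w1); rewrite -K1 -memv_preim linear_homE.
    have -> : (x, w2) = (x - w1, 0) + (w1, w2).
      by congr (_, _); rewrite /= ?subrK ?add0r.
    exact: memvD.
- move=> V' r' f irr' fP fn0.
  (* A map vanishing on [V] is nonzero on [U], where the old list applies. Otherwise its restriction
     to [V] is a nonzero map between irreducibles, and Schur's lemma yields the new entry. *)
  case: (eqVneq (f \o inl_hom V U)%VF 0) => [f1|f1].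
    case: (homU V' r' (f \o inr_hom V U)%VF irr').
    + move=> i; apply/lfunP => y; rewrite !comp_lfunE -[RHS]comp_lfunE -fP comp_lfunE.
      by rewrite dsumE !linear_homE linear0.
    + apply: contraNneq fn0 => f2; apply/eqP/lfunP => -[x y].
      have -> : (x, y) = inl_hom V U x + inr_hom V U y.
        by rewrite !linear_homE [in RHS]/GRing.add /= /add_pair /= addr0 add0r.
      rewrite linearD /= -(comp_lfunE f (inl_hom V U)) -(comp_lfunE f (inr_hom V U)).
      by rewrite f1 f2 !zero_lfunE addr0.
    by move=> q qL eq; exists q => //; right.
  exists (existT _ (dim V) (to_row r)); first by left.
  apply: equivalent_trans (equivalent_to_row r); apply: equivalent_sym.
  apply: schur f1 => // i; apply/lfunP => x.
  by rewrite !comp_lfunE -[RHS]comp_lfunE -fP comp_lfunE dsumE !linear_homE linear0.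
Qed.

(** Without a finite list the sums can be extended forever; one with [D.+1] summands is cyclic of
    dimension greater than [D]. *)
Theorem finitely_many_irreducibles :
  exists L : seq packed, forall (V : vectType C) (r : rep V),
    P r -> irreducible_fam r -> listed L r.
Proof.
apply: NNPP => none.
have ex k : exists L, cyclic_sum k L.
  elim: k => [|k [L kL]]; first by exists [::]; apply: cyclic_sum0.
  apply: NNPP => noS; apply: none.
  (* [irreducible_fam] admits the zero space. It offers no nonzero vector for extending the sum, so
     it is listed separately. *)
  pose z : packed := existT (fun n => rep 'rV[C]_n) 0%N (fun _ => 0).
  exists (z :: L) => V r Pr irr.
  case: (classic (listed L r)) => [[q qL eq]|nL]; first by exists q => //; right.
  case: (classic (exists v : V, v != 0)) => [[v vn0]|V0].
    by case: noS; exists (existT _ (dim V) (to_row r) :: L); apply: cyclic_sumS vn0 nL.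
  have V0E (v : V) : v = 0.
    by apply/eqP/negPn/negP => vn0; apply: V0; exists v.
  exists z; first by left.
  exists 0; split=> /=.
  - by apply/eqP/lker0P => x y _; rewrite (V0E x) (V0E y).
  - by apply/vspaceP => x; rewrite memvf (thinmx0 x) mem0v.
  - by move=> i; rewrite comp_lfun0l comp_lfun0r.
have [L [U [p [u [Pp DU cyc _]]]]] := ex D.+1.
have [W [invW uW dimW]] := P_cyclic Pp u.
by move: dimW; rewrite (cyc W invW uW) dimvf leqNgt DU.
Qed.

End FinitelyMany.

(** * Words in finitely many operators *)

Section WordFiltration.
Variables (V : vectType C) (K : finType) (X : K -> 'End(V)) (v : V).

Fixpoint filt (d : nat) : {vspace V} :=
  if d is d'.+1 then (filt d' + \sum_k X k @: filt d')%VS else <[v]>%VS.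

Definition word (w : seq K) : V := foldr (fun k u => X k u) v w.

Lemma filt_subS d : (filt d <= filt d.+1)%VS.
Proof. exact: addvSl. Qed.

Lemma filt_mono d d' : (d <= d')%N -> (filt d <= filt d')%VS.
Proof.
move=> /subnK <-; elim: (d' - d)%N => [|m IH]; first exact: subvv.
exact: subv_trans IH (filt_subS _).
Qed.

Lemma filt_leq d d' u : (d <= d')%N -> u \in filt d -> u \in filt d'.
Proof. by move=> /filt_mono /subvP; apply. Qed.

Lemma filt_img d k u : u \in filt d -> X k u \in filt d.+1.
Proof.
move=> ud; apply: (subvP (addvSr _ _)).
by apply: (subvP (sumv_sup k _ (subvv _))) => //; apply: memv_img.
Qed.

Lemma filt_comb (f : 'End(V)) (c : K -> C) :
  f = \sum_k c k *: X k -> forall d u, u \in filt d -> f u \in filt d.+1.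
Proof.
move=> -> d u ud; rewrite sum_lfunE memv_suml // => k _.
by rewrite scale_lfunE memvZ ?filt_img.
Qed.

Lemma dim_filt d : (\dim (filt d) <= (#|K|.+1 ^ d))%N.
Proof.
elim: d => [|d IH]; first by rewrite dim_vline leq_b1.
apply: leq_trans (dimv_add_leqif _ _) _.
rewrite expnS mulSn leq_add //.
apply: leq_trans (_ : \sum_(k : K) \dim (filt d) <= _)%N; last first.
  by rewrite sum_nat_const leq_mul2l IH orbT.
apply: leq_trans (dimv_leq_sum _ _ _) _.
by apply: leq_sum => k _; rewrite -(limg_ker_dim (X k) (filt d)) leq_addl.
Qed.

Lemma filt_word w : word w \in filt (size w).
Proof. by elim: w => [|k w IH] /=; rewrite ?memv_line // filt_img. Qed.

Lemma filt_word_cat d p t :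
  word t \in filt d -> word (p ++ t) \in filt (size p + d).
Proof. by move=> td; elim: p => [|k p IH] //=; apply: filt_img. Qed.

Lemma filt_sub_words d (U : {vspace V}) :
  (forall w, (size w <= d)%N -> word w \in U) -> (filt d <= U)%VS.
Proof.
elim: d U => [|d IH] U wU; first by rewrite -memvE (wU [::]).
rewrite subv_add IH => [|w wd]; last by rewrite wU // leqW.
apply/subv_sumP => k _; apply/subvP => _ /memv_imgP[u ud ->].
rewrite memv_preim; apply: (subvP (IH _ _) _ ud) => w wd.
by rewrite -memv_preim (wU (k :: w)).
Qed.

(** Reducing the words of a single length suffices: [filt d.+1] then lies in [filt d], which is
    therefore stable under every letter. *)
Lemma finite_envelope d :
  (forall w, size w = d.+1 -> word w \in filt d) ->
  exists W : {vspace V},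
    [/\ stable_under X W, v \in W & (\dim W <= #|K|.+1 ^ d)%N].
Proof.
move=> red; exists (filt d); split; [move=> k | | exact: dim_filt].
  have sub : (filt d.+1 <= filt d)%VS.
    apply: filt_sub_words => w; rewrite leq_eqVlt ltnS => /orP[/eqP/red //|wd].
    exact: filt_leq wd (filt_word w).
  by apply/subvP => _ /memv_imgP[u ud ->]; apply: (subvP sub); apply: filt_img.
exact: filt_leq (leq0n d) (filt_word [::]).
Qed.

(** * Letters at distance two that anticommute modulo shorter words *)

Section Skew.
Hypothesis skew : forall i j k d u, u \in filt d ->
  X i (X j (X k u)) + X k (X j (X i u)) \in filt d.+2.

(** Modulo shorter words and up to sign, [skew] moves the first [i] two places to the right, until
    one letter separates it from its copy. *)
Lemma repeated_letter m i t s :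
  size t = m.*2.+1 -> word (i :: t ++ i :: s) \in filt (size t + size s).+1.
Proof.
elim: m t => [|m IH] [|j [|k t]] //=.
  (* Both terms of [skew] coincide here, and 2 is invertible in [C]. *)
  move=> _; have := skew i j i (filt_word s).
  by rewrite -mulr2n -scaler_nat rpredZeq Num.Theory.pnatr_eq0.
case=> st; have /(filt_img j)/(filt_img k) kj := IH t st.
have := skew i j k (filt_word (t ++ i :: s)).
rewrite size_cat /= addnS => sk.
by have := memvB sk kj; rewrite addrK.
Qed.

(** A word of length [#|K|.*2.+1] has [#|K|.+1] even positions, so two of them, [a.*2 < b.*2], carry
    the same letter. The [m.*2.+1] letters in between form the odd gap that [repeated_letter]
    requires. *)
Lemma skew_envelope :
  exists W : {vspace V},
    [/\ stable_under X W, v \in W & (\dim W <= #|K|.+1 ^ #|K|.*2)%N].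
Proof.
apply: finite_envelope => w sw.
have [x0 _] : exists x0 : K, true by case: w sw => // x0; exists x0.
pose g (a : 'I_#|K|.+1) := nth x0 w a.*2.
have [/leq_card|/injectivePn[a [b ab gab]]] := altP (injectiveP g).
  by rewrite card_ord ltnn.
wlog lt_ab : a b ab gab / (a < b)%N => [hw|].
  have [lt_ab|ba|/val_inj eab] := ltngtP a b; first exact: (hw a b).
    by apply: (hw b a) => //; rewrite eq_sym.
  by rewrite eab eqxx in ab.
have bs : (b.*2 < size w)%N by rewrite sw ltnS leq_double -ltnS.
have as_ : (a.*2 < size w)%N by apply: leq_ltn_trans bs; rewrite leq_double ltnW.
pose p := take a.*2 w; pose q := drop a.*2.+1 w.
have wE : w = p ++ g a :: q by rewrite -drop_nth // cat_take_drop.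
pose m := (b - a).-1.
have mE : (a.*2.+1 + m.*2.+1 = b.*2)%N.
  have -> : b = (a + m.+1)%N :> nat by rewrite /m prednK ?subn_gt0 // subnKC // ltnW.
  by rewrite doubleD doubleS addSn !addnS.
have qs : (m.*2.+1 < size q)%N.
  by rewrite size_drop -mE in bs *; rewrite -(ltn_add2l a.*2.+1) subnKC.
have qE : q = take m.*2.+1 q ++ g b :: drop m.*2.+2 q.
  rewrite -{1}(cat_take_drop m.*2.+1 q) (drop_nth x0 qs).
  by rewrite nth_drop mE.
have st : size (take m.*2.+1 q) = m.*2.+1 by rewrite size_take qs.
have := filt_word_cat p (repeated_letter (g a) (drop m.*2.+2 q) st).
rewrite {1}gab -gab.
have -> : p ++ g a :: take m.*2.+1 q ++ g a :: drop m.*2.+2 q = w.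
  by rewrite {2}gab -qE -wE.
congr (_ \in filt _).
have := sw; rewrite {1}wE {1}qE !size_cat /= !size_cat /= !addnS => -[<-].
by [].
Qed.

End Skew.

(** * Nilpotent letters that commute modulo shorter words *)

Section Commuting.
Hypothesis comm : forall i j d u, u \in filt d ->
  X i (X j u) - X j (X i u) \in filt d.+1.

Lemma move_letter i w1 w2 :
  word (i :: w1 ++ w2) - word (w1 ++ i :: w2) \in filt (size w1 + size w2).
Proof.
elim: w1 => [|j w1 IH] /=; first by rewrite subrr mem0v.
have := comm i j (filt_word (w1 ++ w2)); rewrite size_cat => cij.
by have := memvD cij (filt_img j IH); rewrite linearB /= subrKA.
Qed.

Lemma permute_word w w' :
  perm_eq w w' -> word w - word w' \in filt (size w).-1.
Proof.
elim: w w' => [|i w IH] w' /=.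
  by rewrite perm_sym => /perm_nilP ->; rewrite subrr mem0v.
move=> ww'; have iw' : i \in w' by rewrite -(perm_mem ww') mem_head.
case/splitPr: iw' ww' => w1 w2.
rewrite perm_sym -cat1s perm_catCA /= perm_cons perm_sym => ww.
have -> : X i (word w) - word (w1 ++ i :: w2) =
    X i (word w - word (w1 ++ w2)) + (word (i :: w1 ++ w2) - word (w1 ++ i :: w2)).
  by rewrite linearB /= subrKA.
apply: memvD; last by rewrite (perm_size ww) size_cat move_letter.
(* For empty [w], [(size w).-1.+1] differs from [size w], so the induction hypothesis does not
   fit. *)
case: (posnP (size w)) => [/size0nil w0|wgt0].
  move: ww; rewrite w0 perm_sym => /perm_nilP ->.
  by rewrite subrr linear0 mem0v.
by rewrite -(prednK wgt0) filt_img ?IH.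
Qed.

(** A word of more than [#|K| * l] letters has a letter occurring at least [l] times. Modulo shorter
    words its copies move to the front, where the [l]-th power vanishes. *)
Lemma nilpotent_envelope l :
  (forall i u, iter l (X i) u = 0) ->
  exists W : {vspace V},
    [/\ stable_under X W, v \in W & (\dim W <= #|K|.+1 ^ (#|K| * l))%N].
Proof.
move=> nil; apply: finite_envelope => w sw.
have [i il] : exists i, (l <= count_mem i w)%N.
  apply: NNPP => no; suff: (size w <= #|K| * l)%N by rewrite sw ltnn.
  rewrite -sum1_size (partition_big id xpredT) //= -sum_nat_const.
  apply: leq_sum => i _; rewrite sum1_count.
  by rewrite leqNgt; apply/negP => /ltnW li; apply: no; exists i.
have := @permute_word w (filter (pred1 i) w ++ filter (predC (pred1 i)) w).
rewrite perm_sym perm_filterC => /(_ (perm_refl w)).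
have /all_pred1P -> : all (pred1 i) (filter (pred1 i) w) by exact: filter_all.
rewrite size_filter -(subnKC il) nseqD -catA.
set z := word (_ ++ _); have -> : z = 0.
  rewrite /z /word foldr_cat; move: (foldr _ v _) => u.
  by rewrite -[RHS](nil i u); elim: (l) => //= m ->.
by rewrite subr0 sw.
Qed.

End Commuting.
End WordFiltration.

(** * Usual and Jacobson representations *)

Section Coordinates.
Variables (T : vectType C).

Definition coor (i : 'I_(dim T)) (u : T) : C := v2r u 0 i.

Lemma coor_inj u w : (forall i, coor i u = coor i w) -> u = w.
Proof. by move=> uw; apply: v2r_inj; apply/rowP. Qed.
Lemma coorD i u w : coor i (u + w) = coor i u + coor i w.
Proof. by rewrite /coor linearD mxE. Qed.
Lemma coorN i u : coor i (- u) = - coor i u.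
Proof. by rewrite /coor linearN mxE. Qed.
Lemma coorZ i c u : coor i (c *: u) = c * coor i u.
Proof. by rewrite /coor linearZ mxE. Qed.
Lemma coor0 i : coor i 0 = 0.
Proof. by rewrite /coor linear0 mxE. Qed.
Definition coorE := (coorD, coorN, coorZ, coor0).

End Coordinates.

(** Linear identities between vectors become identities in [C], coordinate by coordinate. *)
Ltac vector_ring := apply: coor_inj => ?; rewrite !coorE; ring.

Section JordanIdentities.
Variables (T : vectType C) (m : T -> T -> T).
Hypothesis jm : is_jordan m.

Lemma jordan_mulC x y : m x y = m y x.
Proof. by case: jm. Qed.

Lemma jordan_mulPr x c y z : m x (c *: y + z) = c *: m x y + m x z.
Proof. by case: jm => lin _ _; apply: lin. Qed.

Lemma jordan_mulDr x y z : m x (y + z) = m x y + m x z.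
Proof. by have := jordan_mulPr x 1 y z; rewrite !scale1r. Qed.

Lemma jordan_mulDl x y z : m (x + y) z = m x z + m y z.
Proof. by rewrite !(jordan_mulC _ z) jordan_mulDr. Qed.

(** Full linearization of the Jordan identity; [b] is the argument in which it is already linear. *)
Lemma jordan_polarized b x y z :
  m (m (m x y) b) z + m (m (m x z) b) y + m (m (m y z) b) x =
  m (m x y) (m b z) + m (m x z) (m b y) + m (m y z) (m b x).
Proof.
pose t x y z := m (m (m x y) b) z - m (m x y) (m b z).
have t0 u : t u u u = 0 by case: jm => _ _ J; rewrite /t J subrr.
have tC u v w : t u v w = t v u w by rewrite /t (jordan_mulC u).
have tDl u u' v w : t (u + u') v w = t u v w + t u' v w.
  by rewrite /t !jordan_mulDl; vector_ring.
have tDm u v v' w : t u (v + v') w = t u v w + t u v' w.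
  by rewrite !(tC u) tDl.
have tDr u v w w' : t u v (w + w') = t u v w + t u v w'.
  by rewrite /t !jordan_mulDr; vector_ring.
(* Inclusion-exclusion isolates the part linear in each of [x], [y], [z]; by [tC] each of its terms
   occurs twice. *)
have t3 : 2 *: (t x y z + t x z y + t y z x) = 0.
  have <- : t (x + y + z) (x + y + z) (x + y + z) - t (x + y) (x + y) (x + y)
    - t (x + z) (x + z) (x + z) - t (y + z) (y + z) (y + z)
    + t x x x + t y y y + t z z z = 2 *: (t x y z + t x z y + t y z x).
    rewrite !(tDl, tDm, tDr) !(tC y x, tC z x, tC z y); vector_ring.
  by rewrite !t0 !(subr0, addr0).
apply: subr0_eq; move/eqP: t3; rewrite scaler_eq0 Num.Theory.pnatr_eq0 /= => /eqP <-.
by rewrite /t; vector_ring.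
Qed.

End JordanIdentities.

Lemma limg_comb (V : vectType C) (K : finType) (X : K -> 'End(V)) (W : {vspace V})
    (c : K -> C) (f : 'End(V)) :
  stable_under X W -> f = \sum_k c k *: X k -> (f @: W <= W)%VS.
Proof.
move=> sW ->; apply/subvP => _ /memv_imgP[w wW ->].
rewrite sum_lfunE memv_suml // => k _; rewrite scale_lfunE memvZ //.
by apply: (subvP (sW k)); apply: memv_img.
Qed.

Lemma linear_vbasis (U W : vectType C) (f : U -> W) : linear_map f -> forall u,
  f u = \sum_k coord (vbasis fullv) k u *: f (vbasis fullv)`_k.
Proof.
move=> hf u; rewrite -[f]/(linear_fun hf : U -> W).
by rewrite {1}(coord_vbasis (memvf u)) linear_sum; apply: eq_bigr => k _; rewrite linearZ.
Qed.

Section TripleReps.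
Variables (A : vectType C) (mul : A -> A -> A).

(* Satisfied by both usual and Jacobson representations; its leading part
   x b z + z b x is what bounds the length of words. *)
Definition triple_rep (V : vectType C) (phi : A -> 'End(V)) :=
  linear_map phi /\ forall x b z u,
    phi x (phi b (phi z u)) + phi z (phi b (phi x u)) + phi (mul (mul x z) b) u =
    phi (mul x z) (phi b u) + phi (mul x b) (phi z u) + phi (mul z b) (phi x u).

Lemma usual_triple (V : vectType C) (phi : A -> 'End(V)) :
  usual_rep mul phi -> triple_rep phi.
Proof.
case=> lin hom; split=> // x b z u.
have homE y w v : phi (mul y w) v = phi y (phi w v) + phi w (phi y v).
  by rewrite hom add_lfunE !comp_lfunE.
rewrite (homE (mul x z)) (homE x b) (homE z b) !homE !linearD /=; vector_ring.
Qed.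

(** This is the [V]-component of the linearized Jordan identity of [A * V] at [b], [x], [z] in [A]
    and [u] in [V]. *)
Lemma jacobson_triple (V : vectType C) (phi : A -> 'End(V)) :
  is_jordan mul -> jacobson_rep mul phi -> triple_rep phi.
Proof.
move=> jA [lin jV]; split=> // x b z u.
have mul0 y : mul y 0 = 0.
  by have := jordan_mulPr jA y (-1) 0 0; rewrite scaler0 addr0 scaleN1r addNr.
have phi0 : phi 0 = 0 by have := lin (-1) 0 0; rewrite scaler0 addr0 scaleN1r addNr.
have := jordan_polarized jV (b, 0) (x, 0) (z, 0) (0, u).
move=> /(congr1 snd); rewrite /jprod /= !(mul0, phi0, zero_lfunE, linear0, addr0, add0r).
rewrite (jordan_mulC jA b) (jordan_mulC jA b) => E.
by rewrite -addrA [RHS]addrAC -E; vector_ring.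
Qed.

Lemma triple_rep0 : triple_rep (fun _ => 0 : 'End('rV[C]_0)).
Proof. by split=> [c x y|x b z u]; rewrite ?scaler0 ?addr0 // !zero_lfunE. Qed.

Lemma triple_rep_dsum (V W : vectType C) (r : A -> 'End(V)) (q : A -> 'End(W)) :
  triple_rep r -> triple_rep q -> triple_rep (fun x => dsum (r x) (q x)).
Proof.
move=> [rl rt] [ql qt]; split=> [c x y|x b z u].
  apply/lfunP => u; rewrite dsumE add_lfunE scale_lfunE !dsumE rl ql.
  by congr (_, _); rewrite /= add_lfunE scale_lfunE.
by rewrite !dsumE; congr (_, _); [apply: rt | apply: qt].
Qed.

Lemma triple_rep_cyclic (V : vectType C) (r : A -> 'End(V)) :
  triple_rep r -> forall v, exists W : {vspace V},
    [/\ stable_under r W, v \in W & (\dim W <= (\dim {:A}).+1 ^ (\dim {:A}).*2)%N].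
Proof.
move=> [lin tr] v; pose X (k : 'I_(\dim {:A})) := r (vbasis fullv)`_k.
have rE x := linear_vbasis lin x.
have img x d u : u \in filt X v d -> r x u \in filt X v d.+1.
  exact: (filt_comb (rE x)).
have [|W [sW vW dW]] := @skew_envelope V _ X v; last first.
  exists W; split=> // [x|]; first exact: limg_comb sW (rE x).
  by rewrite card_ord in dW.
move=> i j k d u ud; rewrite /X.
(* The remaining terms of the identity apply at most two operators to [u]. *)
have /(canRL (addrK _)) -> := tr (vbasis fullv)`_i (vbasis fullv)`_j (vbasis fullv)`_k u.
apply: memvB; last by apply: filt_leq (leqnSn _) _; apply: img.
by do 2?apply: memvD; do 2 apply: (img).
Qed.

Lemma finitely_many_triple_reps : exists L, forall (V : vectType C) (r : A -> 'End(V)),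
  triple_rep r -> irreducible_fam r -> listed L r.
Proof.
exact: (finitely_many_irreducibles triple_rep0 triple_rep_dsum triple_rep_cyclic).
Qed.

End TripleReps.

(** * Nilpotency of exponentials *)

Lemma iter_linear (V : vectType C) (f : 'End(V)) n : linear_map (iter n f).
Proof. by elim: n => [|n IH] c u v //=; rewrite IH linearP. Qed.

Lemma linear_iter0 (V : vectType C) (f : 'End(V)) n : iter n f 0 = 0.
Proof. by elim: n => //= n ->; rewrite linear0. Qed.

Lemma lbrE (V : vectType C) (f g : 'End(V)) v : lbr f g v = f (g v) - g (f v).
Proof. by rewrite add_lfunE opp_lfunE !comp_lfunE. Qed.

Section Exponential.
Variables (V : vectType C) (l : nat) (a b : 'End(V)).
Let h := lbr b a.
Let p := lbr b h.
Hypothesis ad3 : lbr b p = 0.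

(** The conjugate [exp(b) a exp(-b)], that is [exp(ad b) a]; by [ad3] the series stops at the
    quadratic term. *)
Definition exp_ad := a + h + 2^-1 *: p.

Fixpoint divpow k (v : V) : V :=
  if k is k'.+1 then k%:R^-1 *: b (divpow k' v) else v.
Arguments divpow : simpl never.

Lemma divpowE k v : divpow k v = (k`!%:R : C)^-1 *: iter k b v.
Proof.
elim: k => [|k IH]; first by rewrite invr1 scale1r.
rewrite -[LHS]/(k.+1%:R^-1 *: b (divpow k v)).
by rewrite IH linearZ /= scalerA factS natrM invfM.
Qed.

Lemma divpowS k v : b (divpow k v) = k.+1%:R *: divpow k.+1 v.
Proof. by rewrite /divpow -/divpow scalerA mulfV ?scale1r // Num.Theory.pnatr_eq0. Qed.

Lemma divpow1_ad v : divpow 1 (a v) = a (divpow 1 v) + h v.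
Proof. by rewrite /divpow invr1 !scale1r lbrE addrC subrK. Qed.

(** Leibniz rule for the divided power [b^n / n!] with [n = k.+2]: only three terms survive
    [ad3]. *)
Lemma divpow_ad k v : divpow k.+2 (a v) =
  a (divpow k.+2 v) + h (divpow k.+1 v) + 2^-1 *: p (divpow k v).
Proof.
have ba w : b (a w) = a (b w) + h w by rewrite lbrE addrC subrK.
have bh w : b (h w) = h (b w) + p w by rewrite [p w]lbrE addrC subrK.
have bp w : b (p w) = p (b w).
  by apply: subr0_eq; rewrite -lbrE ad3 zero_lfunE.
elim: k => [|k].
  rewrite -[LHS]/(2^-1 *: b (divpow 1 (a v))) divpow1_ad.
  move: (divpowS 0 v) (divpowS 1 v); rewrite -[divpow 0 v]/v scale1r.
  move: (divpow 1 v) (divpow 2 v) => v1 v2 bv bv1.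
  rewrite linearD /= ba bh bv bv1 linearZ /=.
  by apply: coor_inj => i; rewrite !coorE; field.
rewrite -[divpow k.+3 (a v)]/(k.+3%:R^-1 *: b (divpow k.+2 (a v))) => ->.
move: (divpowS k v) (divpowS k.+1 v) (divpowS k.+2 v).
move: (divpow k v) (divpow k.+1 v) (divpow k.+2 v) (divpow k.+3 v) => v0 v1 v2 v3 b0 b1 b2.
rewrite !linearD !linearZ /= ba bh bp b0 b1 b2 !linearZ /=.
have k0 : k.+3%:R != 0 :> C by rewrite Num.Theory.pnatr_eq0.
apply: coor_inj => i; rewrite !coorE.
rewrite -!natr1 in k0 *.
by field.
Qed.

Hypothesis nil_b : forall v, iter l b v = 0.
Hypothesis nil_a : forall v, iter l a v = 0.

(** This is [exp(b)] once [b^l = 0]. The two extra vanishing terms leave room for the index shifts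
    in [divpow_ad]. *)
Definition expsum (v : V) : V := \sum_(k < l.+2) divpow k v.

Lemma divpow_nil k : (l <= k)%N -> forall v, divpow k v = 0.
Proof. by move=> lk v; rewrite divpowE -(subnK lk) iterD nil_b linear_iter0 scaler0. Qed.

Lemma exp_adE v : exp_ad v = a v + h v + 2^-1 *: p v.
Proof. by rewrite 2!add_lfunE scale_lfunE. Qed.

Lemma exp_adP v : expsum (a v) = exp_ad (expsum v).
Proof.
have hE : h (expsum v) = h v + h (\sum_(k < l) divpow k.+1 v).
  by rewrite /expsum big_ord_recr big_ord_recl /= (divpow_nil (leqnSn l)) addr0 linearD.
have pE : p (expsum v) = p (\sum_(k < l) divpow k v).
  by rewrite /expsum !big_ord_recr /= (divpow_nil (leqnSn l)) (divpow_nil (leqnn l)) !addr0.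
rewrite exp_adE hE pE /expsum !big_ord_recl.
under eq_bigr do rewrite divpow_ad.
rewrite 2!big_split /= -scaler_sumr.
rewrite -[divpow _ (a v)]/(a v) -[divpow (bump 0 0) (a v)]/(divpow 1 (a v)) divpow1_ad.
rewrite -[divpow ord0 v]/v !linearD !linear_sum /=.
by vector_ring.
Qed.

(** By [exp_adP], [exp(b)] intertwines [a] with [exp_ad], so the [l]-th power of [exp_ad] vanishes
    on the image of [expsum]. *)
Lemma nilpotent_exp_ad v : iter l exp_ad v = 0.
Proof.
have gnil w : iter l exp_ad (expsum w) = 0.
  have gE m : iter m exp_ad (expsum w) = expsum (iter m a w).
    by elim: m => //= m ->; rewrite exp_adP.
  by rewrite gE nil_a /expsum big1 // => k _; rewrite divpowE linear_iter0 scaler0.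
(* In place of inverting [exp(b)]: descending induction on [k], since [exp(b)] changes [b^k v] only
   by terms in higher powers of [b]. *)
suff nilb m k : (l <= m + k)%N -> iter l exp_ad (iter k b v) = 0.
  by apply: (nilb l 0%N); rewrite addn0.
elim: m k => [|m IH] k mk.
  by rewrite -(subnK (mk : (l <= k)%N)) iterD nil_b linear_iter0 linear_iter0.
have := gnil (iter k b v); rewrite /expsum big_ord_recl -[divpow 0 _]/(iter k b v).
pose f := linear_hom (iter_linear exp_ad l).
have fE w : iter l exp_ad w = f w by rewrite linear_homE.
rewrite !fE linearD linear_sum /= big1 ?addr0 // => j _.
have fZ c w : iter l exp_ad (c *: w) = c *: iter l exp_ad w.
  by rewrite !fE linearZ.
rewrite linear_homE divpowE -iterD fZ (IH (bump 0 j + k)%N) ?scaler0 //.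
by rewrite /bump add1n addSnnS addnCA (leq_trans mk) // addSn -addnS leq_addl.
Qed.

End Exponential.

(** * The Lie algebra L(A) *)

Lemma lbrC (V : vectType C) (f g : 'End(V)) : lbr f g = - lbr g f.
Proof. by rewrite opprB. Qed.

Lemma lbr_linear (V : vectType C) (f : 'End(V)) : linear_map (lbr f).
Proof.
move=> c g k; apply/lfunP => v; rewrite !(lbrE, add_lfunE, scale_lfunE) linearD linearZ /=.
by vector_ring.
Qed.

Lemma lbr_jacobi (V : vectType C) (f g k : 'End(V)) :
  lbr (lbr f g) k = lbr f (lbr g k) - lbr g (lbr f k).
Proof.
apply/lfunP => v; rewrite add_lfunE opp_lfunE !lbrE !linearB /=.
by vector_ring.
Qed.

Lemma lbrDr (V : vectType C) (f g k : 'End(V)) : lbr f (g + k) = lbr f g + lbr f k.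
Proof. by have := lbr_linear f 1 g k; rewrite !scale1r. Qed.

Lemma lbrN (V : vectType C) (f g : 'End(V)) : lbr f (- g) = - lbr f g.
Proof. by apply/lfunP => v; rewrite opp_lfunE !lbrE !opp_lfunE linearN /=; vector_ring. Qed.

Lemma lbrr (V : vectType C) (f : 'End(V)) : lbr f f = 0.
Proof. exact: subrr. Qed.

Section TKK.
Variables (A : vectType C) (mul : A -> A -> A).
Hypothesis jA : is_jordan mul.
Let mulC := jordan_mulC jA.
Let mulDl := jordan_mulDl jA.
Let mulDr := jordan_mulDr jA.

Lemma mul0r x : mul x 0 = 0.
Proof. by have := jordan_mulPr jA x (-1) 0 0; rewrite scaler0 addr0 scaleN1r addNr. Qed.

Lemma mulZr c x y : mul x (c *: y) = c *: mul x y.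
Proof. by rewrite -[c *: y]addr0 (jordan_mulPr jA) mul0r addr0. Qed.

Lemma mulNr x y : mul x (- y) = - mul x y.
Proof. by rewrite -scaleN1r mulZr scaleN1r. Qed.

Lemma mulZl c x y : mul (c *: x) y = c *: mul x y.
Proof. by rewrite !(mulC _ y) mulZr. Qed.

Lemma mul0l x : mul 0 x = 0.
Proof. by rewrite mulC mul0r. Qed.

Lemma mulNl x y : mul (- x) y = - mul x y.
Proof. by rewrite !(mulC _ y) mulNr. Qed.

(* Normal form modulo commutativity of the products of four factors involved below:
   single letters in front, pairs in alphabetical order. *)
Ltac sort_products a b c d :=
  do ?rewrite (mulC (mul _ _) a); do ?rewrite (mulC (mul _ _) b);
  do ?rewrite (mulC (mul _ _) c); do ?rewrite (mulC (mul _ _) d);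
  rewrite ?(mulC b a) ?(mulC c a) ?(mulC d a) ?(mulC c b) ?(mulC d b) ?(mulC d c);
  rewrite ?(mulC (mul c d) (mul a b)) ?(mulC (mul b d) (mul a c))
    ?(mulC (mul b c) (mul a d)).

(** [[L_a, L_b]] is a derivation: subtract two linearized Jordan identities, with [a] and [b] in
    turn as the distinguished argument. *)
Lemma inner_derivation a b c x :
  mul a (mul b (mul c x)) - mul b (mul a (mul c x))
  - mul c (mul a (mul b x) - mul b (mul a x)) =
  mul (mul a (mul b c) - mul b (mul a c)) x.
Proof.
have := jordan_polarized jA b a c x; have := jordan_polarized jA a b c x.
rewrite mulDl mulNl mulDr mulNr; sort_products a b c x.
do 2 move=> /(canRL (addrK _))/(canRL (addrK _)) ->.
by vector_ring.
Qed.

Lemma L_Aa a b x y :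
  mul a (Aa mul b x y) - Aa mul b (mul a x) y - Aa mul b x (mul a y) =
  - Aa mul (mul a b) x y.
Proof.
have := jordan_polarized jA b a x y.
have := jordan_polarized jA x a b y; have := jordan_polarized jA y a b x.
rewrite /Aa !(mulDr, mulNr); sort_products a b x y.
do 3 move=> /(canRL (addrK _))/(canRL (addrK _)) ->.
by vector_ring.
Qed.

Lemma inU0_0 : inU0 mul (fun _ => 0).
Proof. by exists [::]; split=> //; apply: functional_extensionality => x; rewrite big_nil. Qed.

Lemma inU1_0 : inU1 mul (fun _ _ => 0).
Proof.
exists [::]; split=> //; apply: functional_extensionality => x.
by apply: functional_extensionality => y; rewrite big_nil.
Qed.

Lemma inU0_gen S : U0gen mul S -> inU0 mul S.
Proof.
move=> gS; exists [:: (1, S)]; split; first by constructor.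
by apply: functional_extensionality => x; rewrite big_seq1 scale1r.
Qed.

Lemma inU1_gen B : U1gen mul B -> inU1 mul B.
Proof.
move=> gB; exists [:: (1, B)]; split; first by constructor.
apply: functional_extensionality => x; apply: functional_extensionality => y.
by rewrite big_seq1 scale1r.
Qed.

Lemma inL_m u : inL mul (Lm u).
Proof. by split; [apply: inU0_0 | apply: inU1_0]. Qed.

Lemma inL_0 S : U0gen mul S -> inL mul (L0 S).
Proof. by move=> gS; split; [apply: inU0_gen | apply: inU1_0]. Qed.

Lemma inL_1 B : U1gen mul B -> inL mul (L1 B).
Proof. by move=> gB; split; [apply: inU0_0 | apply: inU1_gen]. Qed.

Lemma U0gen_L a : U0gen mul (Lmul mul a).
Proof. by left; exists a. Qed.
Lemma U0gen_D a b : U0gen mul (fcomm (Lmul mul a) (Lmul mul b)).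
Proof. by right; exists a, b. Qed.
Lemma U1gen_bar : U1gen mul (Abar mul).
Proof. by left. Qed.
Lemma U1gen_A a : U1gen mul (Aa mul a).
Proof. by right; exists a. Qed.

Lemma Lel_eq (X Y : Lel A) : lm X = lm Y -> l0 X =1 l0 Y -> l1 X =2 l1 Y -> X = Y.
Proof.
case: X Y => [u S B] [u' S' B'] /= -> eS eB; congr mkL; apply: functional_extensionality => x.
  exact: eS.
by apply: functional_extensionality => y; apply: eB.
Qed.

(** * Bracket relations in a representation of L(A) *)

Section Representation.
Variables (V : vectType C) (rho : Lel A -> 'End(V)).
Hypothesis rhoP : is_repL mul rho.

Let M u := rho (Lm u).
Let H a := rho (L0 (Lmul mul a)).
Let Q a := rho (L1 (Aa mul a)).
Let Q0 := rho (L1 (Abar mul)).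

Local Hint Resolve inL_m inL_0 inL_1 U0gen_L U0gen_D U1gen_bar U1gen_A : core.

(** Together with [rho_br], this reduces relations between operators to pointwise identities between
    the components of elements of L(A). *)
Lemma rho_comb c X Y Z : inL mul X -> inL mul Y ->
  lm Z = c *: lm X + lm Y -> (forall x, l0 Z x = c *: l0 X x + l0 Y x) ->
  (forall x y, l1 Z x y = c *: l1 X x y + l1 Y x y) -> rho Z = c *: rho X + rho Y.
Proof. by move=> LX LY *; rewrite -(proj1 rhoP) //; congr rho; apply: Lel_eq. Qed.

Lemma rho_br X Y Z : inL mul X -> inL mul Y ->
  lm (Lbr X Y) = lm Z -> (forall x, l0 (Lbr X Y) x = l0 Z x) ->
  (forall x y, l1 (Lbr X Y) x y = l1 Z x y) ->
  lbr (rho X) (rho Y) = rho Z.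
Proof. by move=> LX LY *; rewrite -(proj2 rhoP) //; congr rho; apply: Lel_eq. Qed.

Lemma M_linear : linear_map M.
Proof. by move=> c u v; apply: rho_comb => //= *; rewrite scaler0 addr0. Qed.

Lemma H_linear : linear_map H.
Proof.
move=> c u v; apply: rho_comb; auto => /= *; rewrite ?scaler0 ?addr0 //.
by rewrite /Lmul mulDl mulZl.
Qed.

Lemma Q_linear : linear_map Q.
Proof.
move=> c u v; apply: rho_comb; auto => /= *; rewrite ?scaler0 ?addr0 //.
by rewrite /Aa !(mulDl, mulDr, mulZl, mulZr); vector_ring.
Qed.

Lemma rho_zero : rho (Lm 0) = 0.
Proof. by have := M_linear (-1) 0 0; rewrite scaler0 addr0 scaleN1r addNr. Qed.

Lemma br_MM u v : lbr (M u) (M v) = 0.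
Proof.
rewrite -rho_zero; apply: rho_br => //= *; rewrite /SB ?(subr0, addr0) //.
Qed.

Lemma br_HM a u : lbr (H a) (M u) = M (mul a u).
Proof. by apply: rho_br; auto => //= *; rewrite /SB /Lmul ?(mul0r, subr0, addr0). Qed.

Lemma br_HH a b : lbr (H a) (H b) = rho (L0 (fcomm (Lmul mul a) (Lmul mul b))).
Proof. by apply: rho_br; auto => //= *; rewrite /SB /Lmul ?(mul0r, subr0, addr0). Qed.

Lemma br_HHH a b c :
  lbr (lbr (H a) (H b)) (H c) = H (mul a (mul b c) - mul b (mul a c)).
Proof.
rewrite br_HH; apply: rho_br; auto => //= *; rewrite /SB /fcomm /Lmul ?(mul0r, subr0, addr0) //.
exact: inner_derivation.
Qed.

Lemma br_Q0M u : lbr Q0 (M u) = H u.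
Proof.
by apply: rho_br; auto => //= *; rewrite /SB /Lmul /Abar ?(mul0r, mul0l, subr0, add0r, oppr0).
Qed.

(** Commutativity turns [A_a(u, y)] into [(ua)y + u(ay) - a(uy)]. *)
Lemma br_QM a u : lbr (Q a) (M u) = H (mul u a) + lbr (H u) (H a).
Proof.
rewrite br_HH -[H _]scale1r -(proj1 rhoP); [|by auto|by auto].
apply: rho_br; [by auto|by auto| |move=> x|move=> x y] => /=.
- by rewrite scaler0 addr0 subr0.
- rewrite /Aa /fcomm /Lmul (mulC (mul x a)) (mulC x a) ?mul0r; vector_ring.
- by rewrite /SB /Aa !(mul0r, mul0l); vector_ring.
Qed.

Lemma br_HQ0 a : lbr (H a) Q0 = - Q a.
Proof.
rewrite -[Q a]scale1r -scaleNr -[RHS]addr0 -rho_zero -(proj1 rhoP); [|by auto|by auto].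
apply: rho_br; [by auto|by auto| |move=> x|move=> x y];
  rewrite /= /Lmul /SB /Abar ?(mul0r, mul0l); [by vector_ring|by vector_ring|].
rewrite /Aa (mulC (mul x a)) (mulC x a) (mulC y a) (mulC (mul a y)) (mulC y).
by vector_ring.
Qed.

Lemma br_HQ a b : lbr (H a) (Q b) = - Q (mul a b).
Proof.
rewrite -[Q (mul a b)]scale1r -scaleNr -[RHS]addr0 -rho_zero -(proj1 rhoP); [|by auto|by auto].
apply: rho_br; [by auto|by auto| |move=> x|move=> x y]; rewrite /= /Lmul /SB ?mul0r.
- by vector_ring.
- by rewrite /Aa !(mul0r, mul0l); vector_ring.
- by rewrite L_Aa; vector_ring.
Qed.

Lemma br_Q0Q a : lbr Q0 (Q a) = 0.
Proof.
rewrite -rho_zero; apply: rho_br; [by auto|by auto| |move=> x|move=> x y];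
  by rewrite /= /SB /Abar /Aa ?(mul0r, mul0l); vector_ring.
Qed.

Lemma br_QQ a b : lbr (Q a) (Q b) = 0.
Proof.
rewrite -rho_zero; apply: rho_br; [by auto|by auto| |move=> x|move=> x y];
  by rewrite /= /SB /Aa ?(mul0r, mul0l); vector_ring.
Qed.

(** The image of L(A), presented as a span of generators so that closure under brackets follows by
    cases from the relations above. *)
Inductive tkk : 'End(V) -> Prop :=
| tkk_M u : tkk (M u)
| tkk_H a : tkk (H a)
| tkk_D a b : tkk (lbr (H a) (H b))
| tkk_Q a : tkk (Q a)
| tkk_Q0 : tkk Q0
| tkk_comb c f g : tkk f -> tkk g -> tkk (c *: f + g).
Local Hint Constructors tkk : core.

Lemma tkk_0 : tkk 0.
Proof. by rewrite -rho_zero; apply: tkk_M. Qed.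
Local Hint Resolve tkk_0 : core.

Lemma tkk_N f : tkk f -> tkk (- f).
Proof. by move=> tf; rewrite -scaleN1r -[_ *: f]addr0; auto. Qed.
Local Hint Resolve tkk_N : core.

Lemma tkk_add f g : tkk f -> tkk g -> tkk (f + g).
Proof. by move=> tf tg; rewrite -[f]scale1r; auto. Qed.
Local Hint Resolve tkk_add : core.

Lemma tkk_lbr_H a g : tkk g -> tkk (lbr (H a) g).
Proof.
elim=> {g} [u|b|b c|b||c f g _ tf _ tg].
- by rewrite br_HM.
- by auto.
- by rewrite lbrC br_HHH; auto.
- by rewrite br_HQ; auto.
- by rewrite br_HQ0; auto.
- by rewrite lbr_linear; auto.
Qed.
Local Hint Resolve tkk_lbr_H : core.

Lemma tkk_lbr_D a b g : tkk g -> tkk (lbr (lbr (H a) (H b)) g).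
Proof. by move=> tg; rewrite lbr_jacobi; auto. Qed.
Local Hint Resolve tkk_lbr_D : core.

Lemma tkk_lbr f g : tkk f -> tkk g -> tkk (lbr f g).
Proof.
move=> tf tg; elim: tf => {f} [u|a|a b|a||c f k _ tf _ tk].
- elim: tg => {g} [v|b|b c|b||c f k _ tf _ tk].
  + by rewrite br_MM.
  + by rewrite lbrC; auto.
  + by rewrite lbrC; auto.
  + by rewrite lbrC br_QM; auto.
  + by rewrite lbrC br_Q0M; auto.
  + by rewrite lbr_linear; auto.
- by auto.
- by auto.
- elim: tg => {g} [v|b|b c|b||c f k _ tf _ tk].
  + by rewrite br_QM; auto.
  + by rewrite lbrC; auto.
  + by rewrite lbrC; auto.
  + by rewrite br_QQ.
  + by rewrite lbrC br_Q0Q oppr0.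
  + by rewrite lbr_linear; auto.
- elim: tg => {g} [v|b|b c|b||c f k _ tf _ tk].
  + by rewrite br_Q0M; auto.
  + by rewrite lbrC; auto.
  + by rewrite lbrC; auto.
  + by rewrite br_Q0Q.
  + by rewrite lbrr.
  + by rewrite lbr_linear; auto.
- by rewrite lbrC lbr_linear [lbr g f]lbrC [lbr g k]lbrC; auto.
Qed.

(** The double bracket falls back into U_1, which commutes with [Q a]; this is what truncates
    [exp(ad (Q a))]. *)
Lemma br_QQM a u : exists w, lbr (Q a) (lbr (Q a) (M u)) = Q w.
Proof.
exists (mul (mul u a) a + (mul a (mul u a) - mul u (mul a a))).
rewrite br_QM lbrDr [lbr _ (H _)]lbrC [lbr _ (lbr _ _)]lbrC lbr_jacobi !br_HQ.
rewrite !lbrN !br_HQ !opprK.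
have QB x y : Q (x - y) = Q x - Q y.
  by rewrite addrC -scaleN1r Q_linear scaleN1r addrC.
have QD x y : Q (x + y) = Q x + Q y by have := Q_linear 1 x y; rewrite !scale1r.
by rewrite QD QB opprB.
Qed.

Lemma br_Q0Q0M u : lbr Q0 (lbr Q0 (M u)) = Q u.
Proof. by rewrite br_Q0M lbrC br_HQ0 opprK. Qed.

(** * A finite spanning set of nilpotent operators *)

Let basis : seq A := vbasis fullv.
Let ms := [seq M u | u <- basis].
Let qs := Q0 :: [seq Q a | a <- basis].

(** The brackets [lbr q m] cover U_0 but need not be nilpotent; the conjugates [exp_ad m q] are, and
    they equal [lbr q m] up to U_{-1} and U_1. *)
Definition nilpotent_gens := ms ++ qs ++ [seq exp_ad m q | q <- qs, m <- ms].

Lemma size_nilpotent_gens :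
  size nilpotent_gens = (\dim {:A} + ((\dim {:A}).+1 + (\dim {:A}).+1 * \dim {:A}))%N.
Proof. by rewrite !size_cat size_allpairs /= !size_map !size_tuple. Qed.

Lemma linear_span (f : A -> 'End(V)) (S : {vspace 'End(V)}) : linear_map f ->
  (forall u, u \in basis -> f u \in S) -> forall u, f u \in S.
Proof.
move=> lf fS u; rewrite (linear_vbasis lf) memv_suml // => k _.
by rewrite memvZ // fS // mem_nth // size_tuple.
Qed.

Let S : {vspace 'End(V)} := <<nilpotent_gens>>%VS.

Lemma span_ms m : m \in ms -> m \in S.
Proof. by move=> mm; apply: memv_span; rewrite mem_cat mm. Qed.

Lemma span_qs q : q \in qs -> q \in S.
Proof. by move=> qq; apply: memv_span; rewrite 2!mem_cat qq orbT. Qed.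

Lemma span_exp q m : q \in qs -> m \in ms -> exp_ad m q \in S.
Proof.
move=> qq mm; apply: memv_span; rewrite 2!mem_cat; apply/orP; right; apply/orP; right.
by apply/allpairsP; exists (q, m).
Qed.

Lemma span_M u : M u \in S.
Proof. by apply: (linear_span M_linear) => x xb; rewrite span_ms // map_f. Qed.

Lemma span_Q a : Q a \in S.
Proof.
by apply: (linear_span Q_linear) => x xb; rewrite span_qs // in_cons map_f ?orbT.
Qed.

Lemma lbr_lbr_qm q m : q \in qs -> m \in ms -> exists w, lbr q (lbr q m) = Q w.
Proof.
rewrite in_cons => /orP[/eqP ->|/mapP[a _ ->]] /mapP[u _ ->]; last exact: br_QQM.
by exists u; apply: br_Q0Q0M.
Qed.

Lemma span_lbr_qm q m : q \in qs -> m \in ms -> lbr q m \in S.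
Proof.
move=> qq mm; have [w qqm] := lbr_lbr_qm qq mm.
have -> : lbr q m = exp_ad m q - m - 2^-1 *: Q w.
  by rewrite -qqm /exp_ad [m + _]addrC addrAC addrK addrK.
by rewrite memvB ?memvB ?memvZ ?span_exp ?span_Q ?span_ms.
Qed.

Lemma span_H a : H a \in S.
Proof.
apply: (linear_span H_linear) => x xb; rewrite -br_Q0M.
by rewrite span_lbr_qm ?mem_head // map_f.
Qed.

Lemma span_D a b : lbr (H a) (H b) \in S.
Proof.
have lin f : linear_map (fun x => lbr f (H x)).
  by move=> c x y; rewrite H_linear lbr_linear.
apply: (linear_span (lin (H a))) => y yb; rewrite lbrC memvN.
apply: (linear_span (lin (H y))) => x xb; rewrite lbrC memvN.
have -> : lbr (H x) (H y) = lbr (Q y) (M x) - H (mul x y).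
  by rewrite br_QM addrC addKr.
by rewrite memvB ?span_H // span_lbr_qm ?map_f // in_cons map_f ?orbT.
Qed.

Lemma span_tkk f : tkk f -> f \in S.
Proof.
elim=> [u|a|a b|a||c g k _ gS _ kS].
- exact: span_M.
- exact: span_H.
- exact: span_D.
- exact: span_Q.
- by rewrite span_qs ?mem_head.
- by rewrite memvD ?memvZ.
Qed.

Lemma tkk_gens f : f \in nilpotent_gens -> tkk f.
Proof.
have tm m : m \in ms -> tkk m by move=> /mapP[u _ ->].
have tq q : q \in qs -> tkk q.
  by rewrite in_cons => /orP[/eqP ->|/mapP[a _ ->]].
rewrite 2!mem_cat => /or3P[/tm|/tq|/allpairsP[[q m] /= [/tq tkq /tm tkm ->]]] //.
rewrite /exp_ad; apply: tkk_add; first by apply: tkk_add => //; apply: tkk_lbr.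
by rewrite -[_ *: _]addr0; apply: tkk_comb => //; do 2 apply: tkk_lbr => //.
Qed.

Lemma nil_gens l f : (forall u v, iter l (M u) v = 0) ->
  (forall B, inU1 mul B -> forall v, iter l (rho (L1 B)) v = 0) ->
  f \in nilpotent_gens -> forall v, iter l f v = 0.
Proof.
move=> nM nU; have nm m : m \in ms -> forall v, iter l m v = 0.
  by move=> /mapP[u _ ->].
have nq q : q \in qs -> forall v, iter l q v = 0.
  rewrite in_cons => /orP[/eqP ->|/mapP[a _ ->]]; apply: nU; exact: inU1_gen.
rewrite 2!mem_cat => /or3P[/nm|/nq|/allpairsP[[q m] /= [qq mm ->]]] //.
apply: nilpotent_exp_ad; [|exact: nq|exact: nm].
have [w ->] := lbr_lbr_qm qq mm.
by move: qq; rewrite in_cons => /orP[/eqP ->|/mapP[a _ ->]]; rewrite ?br_Q0Q ?br_QQ.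
Qed.

Lemma rho_cyclic l : (forall u v, iter l (M u) v = 0) ->
  (forall B, inU1 mul B -> forall v, iter l (rho (L1 B)) v = 0) ->
  forall v, exists W : {vspace V},
    [/\ forall u, (M u @: W <= W)%VS, (Q0 @: W <= W)%VS, v \in W &
        (\dim W <= (size nilpotent_gens).+1 ^ (size nilpotent_gens * l))%N].
Proof.
move=> nM nU v; pose X (i : 'I_(size nilpotent_gens)) := nilpotent_gens`_i.
have Xin i : X i \in nilpotent_gens by rewrite mem_nth.
have comb f : tkk f -> f = \sum_i coord (in_tuple nilpotent_gens) i f *: X i.
  by move=> /span_tkk /(coord_span (X := in_tuple nilpotent_gens)).
have [i j d u ud|i u|W [sW vW dW]] := @nilpotent_envelope V _ X v _ l.
- by rewrite -lbrE; apply: (filt_comb (comb _ _)) ud; apply: tkk_lbr; apply: tkk_gens.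
- exact: (nil_gens nM nU).
exists W; split=> // [u||].
- exact: limg_comb sW (comb _ (tkk_M u)).
- exact: limg_comb sW (comb _ tkk_Q0).
by rewrite card_ord in dW.
Qed.

End Representation.
End TKK.

(** * Representations of order l *)

Section Order.
Variables (A : vectType C) (mul : A -> A -> A) (l : nat).
Hypothesis jA : is_jordan mul.

(* Only nilpotency of U_{-1} and U_1 is kept from the l-grading, so that the class
   is closed under direct sums; None indexes the operator a of (pi, a). *)
Definition nil_rep (V : vectType C) (r : option A -> 'End(V)) :=
  exists rho : Lel A -> 'End(V),
  [/\ is_repL mul rho,
      forall u v, iter l (rho (Lm u)) v = 0,
      forall B, inU1 mul B -> forall v, iter l (rho (L1 B)) v = 0 &
      forall o, r o = if o is Some x then rho (Lm x) else - rho (L1 (Abar mul))].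

Lemma nil_rep0 : nil_rep (fun _ => 0 : 'End('rV[C]_0)).
Proof.
exists (fun _ => 0); split=> [|u v|B _ v|[x|]]; rewrite ?oppr0 //; try exact: thinmx0.
split=> *; first by rewrite scaler0 addr0.
by rewrite /lbr comp_lfun0l subrr.
Qed.

Lemma iter_dsum (V W : vectType C) (f : 'End(V)) (g : 'End(W)) n p :
  iter n (dsum f g) p = (iter n f p.1, iter n g p.2).
Proof. by case: p => v w; elim: n => //= n ->; rewrite dsumE. Qed.

Lemma nil_rep_dsum (V W : vectType C) (r : option A -> 'End(V)) (q : option A -> 'End(W)) :
  nil_rep r -> nil_rep q -> nil_rep (fun o => dsum (r o) (q o)).
Proof.
move=> [rho [[rl rb] rm r1 rE]] [sig [[sl sb] sm s1 sE]].
exists (fun X => dsum (rho X) (sig X)); split=> [|u p|B UB p|o].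
- split=> [c X Y LX LY|X Y LX LY]; apply/lfunP => p.
    rewrite dsumE add_lfunE scale_lfunE !dsumE rl // sl //.
    by congr (_, _); rewrite /= add_lfunE scale_lfunE.
  by rewrite lbrE !dsumE rb // sb // !lbrE.
- by rewrite iter_dsum rm sm.
- by rewrite iter_dsum r1 // s1.
- rewrite rE sE; case: o => // ; apply/lfunP => p.
  by rewrite opp_lfunE !dsumE !opp_lfunE.
Qed.

(** [nilpotent_gens] varies with the representation, but its size depends only on [\dim {:A}], so
    one [D] serves every [V]. *)
Lemma nil_rep_cyclic : exists D : nat, forall (V : vectType C) (r : option A -> 'End(V)),
  nil_rep r -> forall v, exists W : {vspace V},
    [/\ stable_under r W, v \in W & (\dim W <= D)%N].
Proof.
pose N := (\dim {:A} + ((\dim {:A}).+1 + (\dim {:A}).+1 * \dim {:A}))%N.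
exists (N.+1 ^ (N * l))%N => V r [rho [rhoP rm r1 rE]] v.
have [W [mW qW vW dW]] := rho_cyclic jA rhoP rm r1 v.
exists W; split=> [[x|]||]; rewrite ?rE //; last by rewrite size_nilpotent_gens in dW.
apply/subvP => _ /memv_imgP[w wW ->]; rewrite opp_lfunE memvN.
by apply: (subvP qW); apply: memv_img.
Qed.

Lemma finitely_many_nil_reps :
  exists L, forall (V : vectType C) (r : option A -> 'End(V)),
    nil_rep r -> irreducible_fam r -> listed L r.
Proof.
have [D cyc] := nil_rep_cyclic.
exact: finitely_many_irreducibles nil_rep0 nil_rep_dsum cyc.
Qed.

(** U_{-1} lowers and U_1 raises the degree by one, so [l] applications leave the range from 1 to
    [l]. *)
Lemma graded_nil (V : vectType C) (rho : Lel A -> 'End(V)) : graded mul l rho ->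
  (forall u v, iter l (rho (Lm u)) v = 0) /\
  (forall B, inU1 mul B -> forall v, iter l (rho (L1 B)) v = 0).
Proof.
move=> [Vs [full _ _ [dn _ up]]].
have nil (f : 'End(V)) : (forall j w, (1 <= j <= l)%N -> w \in Vs j -> iter l f w = 0) ->
    forall v, iter l f v = 0.
  move=> nilj v; pose F := linear_hom (iter_linear f l).
  suff /subvP/(_ v (memvf v)) : (fullv <= lker F)%VS by rewrite memv_ker linear_homE => /eqP.
  rewrite -full big_nat; apply: (big_ind (fun U => (U <= lker F)%VS)) => [|U U' UF U'F|j jl].
  - exact: sub0v.
  - by rewrite subv_add UF.
  - by apply/subvP => w wj; rewrite memv_ker linear_homE; apply/eqP/(nilj j).
have out k w : ~~ (1 <= k <= l)%N -> w \in grade_sp l Vs k -> w = 0.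
  by rewrite /grade_sp => /negPf ->; rewrite memv0 => /eqP.
have inn k w : (1 <= k <= l)%N -> w \in grade_sp l Vs k -> w \in Vs k.
  by rewrite /grade_sp => ->.
(* Once the degree is out of range the vector is 0 and stays 0. This covers [predn] stopping at 0,
   where [grade_sp] is zero. *)
have step (f : 'End(V)) (g : nat -> nat) :
    (forall j, (1 <= j <= l)%N -> (f @: Vs j <= grade_sp l Vs (g j))%VS) ->
    forall n j w, w \in grade_sp l Vs j -> iter n f w \in grade_sp l Vs (iter n g j).
  move=> fg; elim=> [|n IH] j w wj //=.
  move: (IH j w wj); case: (boolP (1 <= iter n g j <= l)%N) => [jl wn|jl /(out _ _ jl) ->].
    by apply: (subvP (fg _ jl)); apply: memv_img; apply: inn wn.
  by rewrite linear0 mem0v.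
have start j w : (1 <= j <= l)%N -> w \in Vs j -> w \in grade_sp l Vs j.
  by rewrite /grade_sp => ->.
have iter_pred n j : iter n predn j = (j - n)%N.
  by elim: n => [|n IH]; rewrite ?subn0 //= IH subnS.
have iter_succ n j : iter n succn j = (j + n)%N.
  by elim: n => [|n IH]; rewrite ?addn0 //= IH addnS.
split=> [u|B UB]; apply: nil => j w jl wj.
- have := step _ predn (fun j jl => dn j u jl) l j w (start j w jl wj).
  apply: out; rewrite iter_pred; case/andP: jl => _ jl.
  by have /eqP -> : (j - l == 0)%N by rewrite subn_eq0.
- have := step _ succn (fun j jl => up j B jl UB) l j w (start j w jl wj).
  apply: out; rewrite iter_succ negb_and -ltnNge; case/andP: jl => j0 _.
  by rewrite -ltnNge -{2}[l]add0n ltn_add2r j0 orbT.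
Qed.

End Order.

Theorem theorem7 (A : vectType C) (mul : A -> A -> A) (e : A) :
  simple_jordan mul -> is_unit mul e ->
  (forall l : nat, (1 <= l)%N ->
     fin_many_genreps (fun V pi a =>
       [/\ is_genrep mul e pi a, genrep_irreducible pi a & gen_order mul l pi a]))
  /\ fin_many_reps (fun V phi => usual_rep mul phi /\ rep_irreducible phi)
  /\ fin_many_reps (fun V phi => jacobson_rep mul phi /\ rep_irreducible phi).
Proof.
move=> [jA _ _] _; split=> [l _|].
  have [L LP] := finitely_many_nil_reps l jA.
  (* Recovers the pair [(pi, a)] from a family indexed by [option A]. *)
  pose conv (q : {n : nat & option A -> 'End('rV[C]_n)}) :
      {n : nat & ((A -> 'End('rV[C]_n)) * 'End('rV[C]_n))%type} :=
    existT _ (projT1 q) (fun x => projT2 q (Some x), projT2 q None).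
  exists (List.map conv L) => V pi a [_ irr [rho [rhoP gr piE aE]]].
  pose r (o : option A) := if o is Some x then pi x else a.
  have nr : nil_rep mul l r.
    have [nm n1] := graded_nil gr.
    by exists rho; split=> // -[x|]; rewrite /r ?piE.
  have ir : irreducible_fam r.
    by move=> W sW; apply: irr => [|x]; [apply: (sW None) | apply: (sW (Some x))].
  have [q qL [f [kf imf fP]]] := LP V r nr ir.
  exists (conv q); first exact: List.in_map.
  by exists f; split=> // [x|]; [apply: (fP (Some x)) | apply: (fP None)].
have [L LP] := finitely_many_triple_reps mul.
split; exists L => V phi [rep irr]; apply: LP => //.
  exact: usual_triple.
exact: jacobson_triple.
Qed.
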